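(* $f(n,1)\le O(n^{1/2}\log^{3/4} n)$; that is, there is an absolute constant $C>0$ such that for every integer $n\ge 2$, $f(n,1)\le C\, n^{1/2}(\log n)^{3/4}$.
   Context: All graphs are finite and simple. For a graph $G$, $G[U]$ denotes the subgraph of $G$ induced on $U\subseteq V(G)$. A graph is regular if all its vertices have the same degree. Define $f(G,1)=\max\{|U| : U\subseteq V(G),\ G[U]\text{ is regular}\}$ and $f(n,1)=\min\{f(G,1): |V(G)|=n\}$. *)

(* Defs.v *)
From HB Require Import structures.
From mathcomp Require Import all_boot all_order all_algebra.
From mathcomp Require Import all_classical all_reals all_analysis.

Set Implicit Arguments.
Unset Strict Implicit.
Unset Printing Implicit Defensive.

Record sgraph := SGraph {
  vertex :> finType;
  adj : rel vertex;
  adj_sym : symmetric adj;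
  adj_irrefl : irreflexive adj
}.

Definition degree (G : sgraph) (x : G) : nat := #|[set y : G | adj x y]|.

Definition regular (G : sgraph) : bool :=
  [forall x : G, forall y : G, degree x == degree y].

Section Induced.
Variables (G : sgraph) (U : {set G}).

Definition induced_adj : rel {x : G | x \in U} :=
  fun x y => adj (val x) (val y).

Lemma induced_adj_sym : symmetric induced_adj.
Proof. by move=> x y; apply: adj_sym. Qed.

Lemma induced_adj_irrefl : irreflexive induced_adj.
Proof. by move=> x; apply: adj_irrefl. Qed.

Definition induced : sgraph := SGraph induced_adj_sym induced_adj_irrefl.
End Induced.

(* f(G,1). The empty subgraph is vacuously regular, so the range of the
   maximum is never empty. *)
Definition max_regular_induced (G : sgraph) : nat :=
  \max_(U : {set G} | regular (induced U)) #|U|.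

Definition regular_induced_value (n : nat) : pred nat :=
  fun k => `[< exists G : sgraph, #|G| = n /\ max_regular_induced G = k >].

Definition edgeless (n : nat) : sgraph :=
  @SGraph 'I_n (fun _ _ => false) (fun _ _ => erefl) (fun _ => erefl).

Lemma regular_induced_value_ex (n : nat) : exists k, regular_induced_value n k.
Proof.
exists (max_regular_induced (edgeless n)); apply/asboolP.
by exists (edgeless n); split; first exact: card_ord.
Qed.

(* f(n,1): the least value of f(G,1) over all graphs G on n vertices. *)
Definition min_max_regular_induced (n : nat) : nat :=
  ex_minn (regular_induced_value_ex n).

(* Main.v *)
Require Import Defs.
From HB Require Import structures.
From mathcomp Require Import all_boot all_order all_algebra.
From mathcomp Require Import all_classical all_reals all_analysis.
From mathcomp Require Import ring lra zify.

(* Put the vertices at positions x_i = i/n and join i and j independently with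
   probability 1/4 + (x_i + x_j)/4. Let U be a set of k vertices.
   - Exposing the edges inside U vertex by vertex, each vertex hits a prescribed
     degree with probability O(1/sqrt r), where r vertices are still to come; so
     U is d-regular with probability at most (c/sqrt k)^k.
   - If U is regular then sum_(i in U) (x_i - mean) deg(i) = 0, whereas the
     expectation of this statistic is (k-2) V / 4 with
     V = sum_(i in U) (x_i - mean)^2. Its variance is of the same order, so an
     exponential moment bounds the probability by exp(-(k-2) V / 96).
   A geometric mean of the two bounds, with weight 1/(2 log n) on the second,
   has the form sum_m prod_(i in U) a_(m,i) with Gaussian factors a_(m,i) centred
   at m, so the union bound over all large U is a product over the vertices. *)

Set Implicit Arguments.
Unset Strict Implicit.
Unset Printing Implicit Defensive.

Import Order.TTheory GRing.Theory Num.Theory.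
Local Open Scope ring_scope.

(** * Product measures of independent Bernoulli coordinates *)

Section ProductBernoulli.
Variables (R : realType) (I : finType) (p : I -> R).
Hypothesis p01 : forall i, 0 <= p i <= 1.
Implicit Types (w : {ffun I -> bool}) (f g : {ffun I -> bool} -> R).

Definition weight w : R := \prod_i (if w i then p i else 1 - p i).
Definition expect f : R := \sum_w weight w * f w.

Lemma weight_ge0 w : 0 <= weight w.
Proof.
apply: prodr_ge0 => i _; have /andP[p0 p1] := p01 i.
by case: ifP => _ //; rewrite subr_ge0.
Qed.

Lemma expect_prod (g : I -> bool -> R) :
  expect (fun w => \prod_i g i (w i)) =
  \prod_i (p i * g i true + (1 - p i) * g i false).
Proof.
under [RHS]eq_bigr => i _.
  rewrite (_ : _ + _ = \sum_(b : bool) (if b then p i else 1 - p i) * g i b).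
    over.
  by rewrite big_bool.
rewrite bigA_distr_bigA; apply: eq_bigr => w _.
by rewrite big_split.
Qed.

Lemma expect_cst c : expect (fun=> c) = c.
Proof.
rewrite /expect -mulr_suml [X in X * _](_ : _ = expect (fun w => \prod_(i : I) 1)).
  by rewrite (expect_prod (fun _ _ => 1)) big1 ?mul1r // => i _; rewrite !mulr1 addrC subrK.
by apply: eq_bigr => w _; rewrite big1 ?mulr1.
Qed.

Lemma expect_le f g : (forall w, f w <= g w) -> expect f <= expect g.
Proof. by move=> fg; apply: ler_sum => w _; rewrite ler_wpM2l ?weight_ge0. Qed.

Lemma eq_expect f g : f =1 g -> expect f = expect g.
Proof. by move=> fg; apply: eq_bigr => w _; rewrite fg. Qed.

Lemma expectZr c f : expect (fun w => f w * c) = expect f * c.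
Proof. by rewrite /expect mulr_suml; apply: eq_bigr => w _; rewrite mulrA. Qed.

Lemma expect_sum (J : finType) (P : pred J) (F : J -> {ffun I -> bool} -> R) :
  expect (fun w => \sum_(j | P j) F j w) = \sum_(j | P j) expect (F j).
Proof.
by rewrite /expect exchange_big; apply: eq_bigr => w _; rewrite mulr_sumr.
Qed.

Definition splice (A : pred I) w w' : {ffun I -> bool} :=
  [ffun i => if A i then w i else w' i].

(* Swapping the coordinates outside [A] is a weight-preserving involution on
   pairs of configurations; this replaces conditioning on the coordinates
   in [A]. *)
Lemma expect_splice (A : pred I) f :
  expect f = expect (fun w => expect (fun w' => f (splice A w w'))).
Proof.
pose sw (u : {ffun I -> bool} * {ffun I -> bool}) :=
  (splice A u.1 u.2, splice A u.2 u.1).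
have swK : involutive sw.
  by move=> [w w']; congr pair; apply/ffunP => i; rewrite !ffunE; case: (A i).
transitivity (\sum_(u : {ffun I -> bool} * {ffun I -> bool})
   weight u.1 * weight u.2 * f u.1).
  rewrite -(pair_bigA _ (fun w w' => weight w * weight w' * f w)) /=.
  apply: eq_bigr => w _; rewrite -[in LHS](expect_cst (f w)) mulr_sumr.
  by apply: eq_bigr => w' _; rewrite mulrA.
rewrite (reindex_inj (inv_inj swK)) /=.
rewrite [RHS](_ : _ = \sum_w \sum_w' weight w * weight w' * f (splice A w w')).
  rewrite [RHS]pair_bigA /=; apply: eq_bigr => -[w w'] _ /=; congr (_ * _).
  rewrite /weight -!big_split; apply: eq_bigr => i _ /=.
  by rewrite !ffunE; case: (A i) => //; rewrite mulrC.
by apply: eq_bigr => w _; rewrite mulr_sumr; apply: eq_bigr => w' _; rewrite mulrA.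
Qed.

End ProductBernoulli.

(** * Anticoncentration of sums of independent Bernoulli variables *)

Section PoissonBinomial.
Variable R : realType.
Implicit Types (ps : seq R) (t : int).

(** Probability that a sum of independent Bernoulli variables with parameters [ps] equals [t]; [t]
    is an integer so that [t - 1] never truncates. *)
Fixpoint pbinom ps t : R :=
  if ps is p :: ps' then p * pbinom ps' (t - 1) + (1 - p) * pbinom ps' t
  else (t == 0)%:R.

Lemma pbinom_rcons_half ps t :
  pbinom (rcons ps 2^-1) t = (pbinom ps (t - 1) + pbinom ps t) / 2.
Proof.
elim: ps t => [|p ps IH] t /=; last by rewrite !IH; field.
by field.
Qed.

Lemma bin_le_central m k : ('C(m, k) <= 'C(m, m./2))%N.
Proof.
have up a : (a.*2 < m)%N -> ('C(m, a) <= 'C(m, a.+1))%N.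
  move=> am; rewrite -(leq_pmul2l (ltn0Sn a)) mul_bin_left leq_mul2r.
  by apply/orP; right; lia.
have le_half a b : (a <= b)%N -> (b <= m./2)%N -> ('C(m, a) <= 'C(m, b))%N.
  elim: b => [|b IH]; first by rewrite leqn0 => /eqP ->.
  rewrite leq_eqVlt => /orP[/eqP -> //|ab bm].
  by apply: leq_trans (IH _ _) (up _ _); lia.
have [km|mk] := leqP k m./2; first exact: le_half.
have [km|?] := leqP k m; last by rewrite bin_small.
by rewrite -bin_sub //; apply: le_half; lia.
Qed.

(** Consecutive central coefficients have ratio 2(2a+1)/(a+1), so the induction reduces to
    4(2a+1)^2(3a+4) <= 16(a+1)^2(3a+1), whose sides differ by 4a. *)
Lemma central_bin_bound a : ('C(a.*2, a) ^ 2 * (3 * a + 1) <= 4 ^ a.*2)%N.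
Proof.
elim: a => [//|a IH].
have E : (a.+1 * 'C(a.+1.*2, a.+1) = 2 * (2 * a + 1) * 'C(a.*2, a))%N.
  have /= D := mul_bin_diag a.*2.+2 a; have /= B := mul_bin_down a.*2.+1 a.
  rewrite (_ : a.*2.+1 - a = a.+1)%N in B; last by lia.
  apply/eqP; rewrite doubleS -(eqn_pmul2l (ltn0Sn a)) -D; apply/eqP.
  rewrite (_ : a.*2.+2 = 2 * a.+1)%N; last by lia.
  by rewrite -(mulnA 2 a.+1) -B -[in RHS](mulnA 2) -mul2n addn1.
move: IH E; move: 'C(_, _) 'C(_, _) => x y IH E.
rewrite doubleS !expnS; move: (4 ^ _)%N IH => z IH.
rewrite -(@leq_pmul2l (a.+1 ^ 2 * (3 * a + 1))) ?muln_gt0 ?expn_gt0 ?addn1 //.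
apply: leq_trans (_ : (2 * (2 * a + 1)) ^ 2 * (3 * a + 4) * z <= _)%N; last first.
  rewrite !mulnA leq_mul2r; apply/orP; right; rewrite !expnS expn0; nia.
apply: leq_trans (_ : (2 * (2 * a + 1)) ^ 2 * (3 * a + 4) * (y ^ 2 * (3 * a + 1)) <= _)%N.
  rewrite (_ : a.+1 ^ 2 * _ * _ = (a.+1 * x) ^ 2 * ((3 * a + 1) * (3 * a + 4)))%N.
    by rewrite E !expnMn; lia.
  by rewrite expnMn; lia.
by rewrite leq_mul2l IH orbT.
Qed.
Lemma max_bin_bound m k : ('C(m, k) ^ 2 * m.+1 <= 4 ^ m)%N.
Proof.
apply: (@leq_trans ('C(m, m./2) ^ 2 * m.+1)).
  by rewrite leq_mul2r leq_exp2r // bin_le_central orbT.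
rewrite -{1 3 4}(odd_double_half m); case: (odd m); move: m./2 => a.
  have /= D := mul_bin_diag a.*2.+2 a; have := central_bin_bound a.+1.
  have {D} -> : 'C(a.+1.*2, a.+1) = (2 * 'C(a.*2.+1, a))%N.
    apply/eqP; rewrite -(eqn_pmul2l (ltn0Sn a)) -D; apply/eqP.
    by rewrite mulnA -[in RHS](mulnC 2) -doubleS -mul2n.
  rewrite add1n doubleS !expnS; move: 'C(_, _) (4 ^ _)%N => x y; nia.
rewrite add0n; apply: leq_trans (central_bin_bound a).
by rewrite leq_mul2l; apply/orP; right; lia.
Qed.

Lemma pbinom_nseq_half m t :
  pbinom (nseq m 2^-1) t = if t is Posz k then 'C(m, k)%:R / 2 ^+ m else 0.
Proof.
elim: m t => [|m IH] [k|k] /=.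
- by case: k => [|k]; rewrite expr0 divr1.
- by [].
- case: k => [|k].
    rewrite (_ : 0 - 1 = Negz 0) // !IH !bin0 exprS; field.
    by rewrite expf_neq0 ?pnatr_eq0.
  rewrite (_ : k.+1%:Z - 1 = k%:Z); last by lia.
  rewrite !IH binS natrD exprS; field.
  by rewrite expf_neq0 ?pnatr_eq0.
- rewrite (_ : Negz k - 1 = Negz k.+1); last by lia.
  by rewrite !IH; field.
Qed.

Lemma pbinom_nseq_half_le m t :
  pbinom (nseq m 2^-1) t <= (Num.sqrt (m.+1)%:R)^-1.
Proof.
rewrite pbinom_nseq_half; case: t => [k|_]; last by rewrite invr_ge0 sqrtr_ge0.
have s0 : 0 < Num.sqrt (m.+1%:R : R) by rewrite sqrtr_gt0 ltr0n.
rewrite ler_pdivrMr ?exprn_gt0 // ler_pdivlMl //.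
rewrite -(@ler_pXn2r _ 2) ?nnegrE ?mulr_ge0 ?exprn_ge0 ?sqrtr_ge0 //.
rewrite exprMn sqr_sqrtr // exprAC -natrX -natrX -natrX -natrM ler_nat mulnC.
exact: max_bin_bound.
Qed.

(** The mean is at most the quadratic mean, which leaves a rational inequality. The shift 1/4 is
    what each biased summand contributes in [pbinom_cat_le]. *)
Lemma midpoint_inv_sqrt (x : R) : 1 <= x ->
  ((Num.sqrt x)^-1 + (Num.sqrt (x + 1))^-1) / 2 <= (Num.sqrt (x + 4^-1))^-1.
Proof.
move=> x1; have [x0 x0' x0''] : [/\ 0 < x, 0 < x + 1 & 0 < x + 4^-1] by split; lra.
rewrite -!sqrtrV ?(ltW x0) ?(ltW x0') ?(ltW x0'') //.
rewrite -(@ler_pXn2r _ 2) ?nnegrE ?divr_ge0 ?addr_ge0 ?sqrtr_ge0 //.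
set a := Num.sqrt _; set b := Num.sqrt _.
have a2 : a ^+ 2 = x^-1 by rewrite sqr_sqrtr // invr_ge0 ltW.
have b2 : b ^+ 2 = (x + 1)^-1 by rewrite sqr_sqrtr // invr_ge0 ltW.
rewrite sqr_sqrtr ?invr_ge0 ?(ltW x0'') //.
apply: (@le_trans _ _ ((x^-1 + (x + 1)^-1) / 2)).
  rewrite -a2 -b2; have := sqr_ge0 (a - b); lra.
rewrite -subr_ge0.
have -> : (x + 4^-1)^-1 - (x^-1 + (x + 1)^-1) / 2 =
   (2 * x - 1) / (2 * (4 * x + 1) * x * (x + 1)).
  by field; rewrite ?gt_eqF //; lra.
by apply: divr_ge0; [lra|rewrite !mulr_ge0 //; lra].
Qed.

(* A Bernoulli(p) variable with 1/4 <= p <= 3/4 is, with probability 1/2, a fair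
   coin, so half of the summands may be traded for fair coins. *)
Lemma pbinom_cat_le ps m t : all (fun p => 4^-1 <= p <= 3 / 4) ps ->
  pbinom (ps ++ nseq m 2^-1) t <= (Num.sqrt (m.+1%:R + (size ps)%:R / 4))^-1.
Proof.
elim: ps m t => [|p ps IH] m t /=.
  by rewrite mul0r addr0 => _; exact: pbinom_nseq_half_le.
move=> /andP[/andP[p1 p2] /IH{}IH].
have {IH} := (IH m.+1 t, IH m t, IH m (t - 1)).
have -> : nseq m.+1 (2^-1 : R) = rcons (nseq m 2^-1) 2^-1.
  by rewrite -cats1 -(nseqD m 1) addn1.
rewrite -rcons_cat pbinom_rcons_half.
set x := m.+1%:R + (size ps)%:R / 4.
have x1 : 1 <= x.
  by have := ler0n R m; have := ler0n R (size ps); rewrite /x -natr1; lra.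
have -> : m.+2%:R + (size ps)%:R / 4 = x + 1 by rewrite /x -natr1; ring.
have -> : m.+1%:R + (size ps).+1%:R / 4 = x + 4^-1 by rewrite /x -[in LHS]natr1; field.
have := midpoint_inv_sqrt x1.
move: (Num.sqrt x)^-1 (Num.sqrt _)^-1 (Num.sqrt _)^-1 => b b' b''.
(* For the values A at [t - 1] and B at [t], pA + (1-p)B = (A+B)/4 + (p-1/4)A + (3/4-p)B. The
   average (A+B)/2 has the bound with one more fair coin; the last two terms have nonnegative
   weights of total 1/2. *)
move: (pbinom _ _) (pbinom _ _) => g g' mid [[H1 H2] H3]; nra.
Qed.

Lemma pbinom_le ps t : all (fun p => 4^-1 <= p <= 3 / 4) ps ->
  pbinom ps t <= (Num.sqrt (1 + (size ps)%:R / 4))^-1.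
Proof. by move=> /(@pbinom_cat_le ps 0 t); rewrite cats0. Qed.

End PoissonBinomial.

(** * Random edges and vertex-by-vertex exposure of degrees *)

Section Exposure.
Variables (R : realType) (n : nat) (p : 'I_n * 'I_n -> R).
Hypothesis p_mid : forall e, 4^-1 <= p e <= 3 / 4.
Implicit Types (s : seq 'I_n) (w : {ffun 'I_n * 'I_n -> bool}) (i j u : 'I_n).

Let p01 e : 0 <= p e <= 1.
Proof. by have := p_mid e; lra. Qed.

(** The sample space has a coordinate for every ordered pair; an edge reads the one with the smaller
    index first, so it is symmetric and distinct edges are independent. *)
Definition upair i j := if (i < j)%N then (i, j) else (j, i).
Definition edge w i j : bool := w (upair i j).
Definition deg_in s w i : int := \sum_(j <- s | j != i) (edge w i j)%:R.

Lemma upairC i j : upair i j = upair j i.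
Proof. by rewrite /upair; case: ltngtP => // /val_inj ->. Qed.

Lemma upair_inj u : injective (upair u).
Proof.
move=> i j; rewrite /upair.
by case: ifP => _; case: ifP => _ [] => // -> ->.
Qed.

Lemma upair_touch u i j :
  ((upair i j).1 == u) || ((upair i j).2 == u) = (i == u) || (j == u).
Proof. by rewrite /upair; case: ifP => _ //=; rewrite orbC. Qed.

Lemma expect_edge u j (h : bool -> R) :
  expect p (fun w => h (edge w u j)) =
  p (upair u j) * h true + (1 - p (upair u j)) * h false.
Proof.
pose g e b := if e == upair u j then h b else 1.
rewrite (@eq_expect _ _ _ _ (fun w => \prod_e g e (w e))); last first.
  move=> w; rewrite (bigD1 (upair u j)) //= big1 ?mulr1 /g ?eqxx //.
  by move=> e /negPf ->.
rewrite expect_prod (bigD1 (upair u j)) //= [X in _ * X]big1 ?mulr1 /g ?eqxx //.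
by move=> e /negPf ->; rewrite !mulr1 addrC subrK.
Qed.

Lemma expect_star u s (t : int) : uniq s ->
  expect p (fun w => (\sum_(j <- s) ((edge w u j)%:R : int) == t)%:R) =
  pbinom [seq p (upair u j) | j <- s] t.
Proof.
elim: s t => [|j s IH] t /=.
  by move=> _; under eq_expect => w do rewrite big_nil; rewrite expect_cst // eq_sym.
move=> /andP[js us].
rewrite (expect_splice p (pred1 (upair u j))).
transitivity (expect p (fun w => pbinom [seq p (upair u j) | j <- s] (t - (edge w u j)%:R))).
  apply: eq_expect => w; rewrite -IH //; apply: eq_expect => w'.
  rewrite big_cons addrC eq_sym -subr_eq eq_sym {2}/edge ffunE /= eqxx.
  congr ((_ == _)%:R); apply: eq_big_seq => k ks.
  rewrite /edge ffunE /= (inj_eq (@upair_inj u)).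
  by case: eqP => // kj; rewrite -kj ks in js.
by rewrite (expect_edge u j (fun b => pbinom _ (t - b%:R))) subr0.
Qed.

Lemma expect_star_le u s (t : int) : uniq s ->
  expect p (fun w => (\sum_(j <- s) ((edge w u j)%:R : int) == t)%:R) <=
  (Num.sqrt (1 + (size s)%:R / 4))^-1.
Proof.
move=> us; rewrite expect_star // -(size_map (fun j => p (upair u j)) s).
by apply: pbinom_le; apply/allP => _ /mapP[j _ ->].
Qed.

(* Expose the edges at the vertices of [s] one vertex at a time: each vertex meets
   its prescribed degree with probability O(1/sqrt r), where r is the number
   of vertices still to come. *)
Lemma expect_degrees_le s (d : 'I_n -> int) : uniq s ->
  expect p (fun w => (all (fun i => deg_in s w i == d i) s)%:R) <=
  \prod_(r < size s) (Num.sqrt (1 + r%:R / 4))^-1.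
Proof.
elim: s d => [|u s IH] d /=; first by rewrite big_ord0 expect_cst.
move=> /andP[us uniqs].
rewrite big_ord_recr /= (expect_splice p [pred e | (e.1 == u) || (e.2 == u)]).
have B0 : 0 <= \prod_(r < size s) (Num.sqrt (1 + r%:R / 4) : R)^-1.
  by apply: prodr_ge0 => r _; rewrite invr_ge0 sqrtr_ge0.
have neq i : i \in s -> i != u by apply: contraTneq => ->.
apply: (@le_trans _ _ (expect p (fun w =>
    (\sum_(j <- s) ((edge w u j)%:R : int) == d u)%:R *
    \prod_(r < size s) (Num.sqrt (1 + r%:R / 4))^-1))); last first.
  by rewrite expectZr mulrC ler_wpM2l // expect_star_le.
apply: expect_le => // w.
(* With the edges at [u] fixed by [w], the condition at [u] is constant in [w'], and the others
   become degree conditions within [s] with shifted targets, covered by the induction hypothesis. *)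
rewrite (@eq_expect _ _ _ _ (fun w' =>
    (all (fun i => deg_in s w' i == d i - (edge w i u)%:R) s)%:R *
    (\sum_(j <- s) ((edge w u j)%:R : int) == d u)%:R)).
  by rewrite expectZr mulrC ler_wpM2l ?IH.
move=> w'; rewrite -natrM mulnb [in RHS]andbC; congr ((_ && _)%:R).
  congr (_ == _); rewrite /deg_in big_cons eqxx big_seq_cond [RHS]big_seq.
  apply: eq_big => [j|j /andP[js _]]; first by case js: (j \in s); rewrite //= neq.
  by rewrite /edge ffunE /= upair_touch eqxx.
apply: eq_in_all => i si.
rewrite /deg_in big_cons [u == i]eq_sym neq // addrC eq_sym -subr_eq eq_sym.
rewrite {2}/edge ffunE /= upair_touch eqxx orbT; congr (_ == _).
rewrite big_seq_cond [RHS]big_seq_cond; apply: eq_bigr => j /andP[js _].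
by rewrite /edge ffunE /= upair_touch !(negPf (neq _ _)).
Qed.

End Exposure.

(** * Exponential estimates and the moment bound for spread-out sets *)

Section Chernoff.
Variable R : realType.

(** By induction: k(ln(k+1) - ln k) <= 1 and ln(k+1) <= 2 + ln(1 + k/4), and 3/2 is half of 1 +
    2. *)
Lemma prod_inv_sqrt_le (k : nat) :
  \prod_(r < k) (Num.sqrt (1 + r%:R / 4 : R))^-1 <=
  expR (3 / 2 * k%:R - k%:R / 2 * ln k%:R).
Proof.
elim: k => [|k IH]; first by rewrite big_ord0 !mul0r mulr0 subr0 expR0.
have k4 : 0 < 1 + k%:R / 4 :> R by rewrite ltr_pwDl // divr_ge0.
rewrite big_ord_recr /=.
have -> : (Num.sqrt (1 + k%:R / 4 : R))^-1 = expR (- (ln (1 + k%:R / 4) / 2)).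
  rewrite expRN; congr _^-1; rewrite -[in LHS](lnK k4) [in LHS](splitr (ln _)).
  by rewrite expRD -expr2 sqrtr_sqr ger0_norm ?expR_ge0.
apply: (le_trans (ler_wpM2r (expR_ge0 _) IH)).
rewrite -expRD ler_expR.
have l4 : ln (k.+1%:R : R) <= 2 + ln (1 + k%:R / 4).
  have ln2 : ln (2 : R) <= 1 by rewrite -[X in ln X](_ : 1 + 1 = 2) // le_ln1Dx //; lra.
  apply: (@le_trans _ _ (ln (2 * 2 * (1 + k%:R / 4)))).
    by rewrite ler_ln ?posrE ?mulr_gt0 // -natr1; lra.
  by rewrite !lnM ?posrE ?mulr_gt0 //; lra.
have l1 : k%:R * (ln (k.+1%:R : R) - ln k%:R) <= 1.
  have [->|k0] := posnP k; first by rewrite mul0r ler01.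
  have k0R : 0 < k%:R :> R by rewrite ltr0n.
  rewrite -ln_div ?posrE // -natr1 mulrDl mulfV ?gt_eqF // mul1r mulrC.
  rewrite -ler_pdivlMr // mul1r le_ln1Dx //.
  by apply: lt_trans (_ : 0 < _); rewrite ?invr_gt0 // oppr_lt0.
move: l4 l1; rewrite -natr1.
move: (ln _) (ln _) (ln _) => a b c; nra.
Qed.

(** From exp(-x) >= 1 - x and (1 - x)(1 + x + 2x^2) = 1 + x^2(1 - 2x) >= 1. *)
Lemma expR_le_quad (x : R) : x <= 1 / 2 -> expR x <= 1 + x + 2 * x ^+ 2.
Proof.
move=> x2; rewrite -[x in expR x]opprK expRN -[leRHS]invrK.
have h : 0 < 1 + x + 2 * x ^+ 2 by nra.
rewrite lef_pV2 ?posrE ?invr_gt0 ?expR_gt0 //.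
apply: le_trans (expR_ge1Dx _).
rewrite -[leLHS]mul1r ler_pdivrMr //; nra.
Qed.

Lemma sum_offdiag (n : nat) (h : 'I_n -> 'I_n -> R) :
  \sum_i \sum_(j | j != i) h i j =
  \sum_(e : 'I_n * 'I_n | (e.1 < e.2)%N) (h e.1 e.2 + h e.2 e.1).
Proof.
rewrite big_split /= -(pair_big_dep xpredT (fun i j : 'I_n => (i < j)%N)) /=.
rewrite -(pair_big_dep xpredT (fun i j : 'I_n => (i < j)%N) (fun i j => h j i)) /=.
rewrite [X in _ + X](exchange_big_dep xpredT) //= -big_split /=.
apply: eq_bigr => i _; rewrite (bigID (fun j : 'I_n => (i < j)%N)) /=.
by congr (_ + _); apply: eq_bigl => j; rewrite -val_eqE /= /xpredT; case: ltngtP.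
Qed.

Section Deviation.
Variables (n : nat) (x : 'I_n -> R) (U : {set 'I_n}).
Hypothesis x01 : forall i, 0 <= x i <= 1.
Hypothesis U0 : (0 < #|U|)%N.

Definition edge_prob (e : 'I_n * 'I_n) : R := 1 / 4 + (x e.1 + x e.2) / 4.
Definition mean : R := (\sum_(i in U) x i) / #|U|%:R.
Definition spread : R := \sum_(i in U) (x i - mean) ^+ 2.

Lemma edge_prob_mid e : 4^-1 <= edge_prob e <= 3 / 4.
Proof. by rewrite /edge_prob; have := x01 e.1; have := x01 e.2; lra. Qed.

Let a i : R := (i \in U)%:R.
Let y i : R := x i - mean.
Let k : R := #|U|%:R.

Let k0 : 0 < k. Proof. by rewrite ltr0n. Qed.

Let sum_a : \sum_i a i = k.
Proof. by rewrite /k -sum1_card natr_sum [RHS]big_mkcond; apply: eq_bigr => i _; rewrite /a; case: (i \in U). Qed.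

Let aa i : a i * a i = a i.
Proof. by rewrite /a -natrM mulnb andbb. Qed.

Let sum_inE (f : 'I_n -> R) : \sum_(i in U) f i = \sum_i a i * f i.
Proof.
by rewrite big_mkcond; apply: eq_bigr => i _; rewrite /a; case: ifP; rewrite ?mul1r ?mul0r.
Qed.

Let sum_ay : \sum_i a i * y i = 0.
Proof.
rewrite -sum_inE sumrB sumr_const -mulr_natr /mean mulfVK ?subrr //.
by rewrite pnatr_eq0 -lt0n.
Qed.

Lemma mean01 : 0 <= mean <= 1.
Proof.
rewrite divr_ge0 ?ler0n ?sumr_ge0 //=; last by move=> i _; case/andP: (x01 i).
rewrite ler_pdivrMr ?k0 // mul1r -[leRHS]/k -sum_a sum_inE.
apply: ler_sum => i _; rewrite -[leRHS]mulr1 ler_wpM2l ?ler0n //.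
by case/andP: (x01 i).
Qed.

Let sumD1 (f : 'I_n -> R) i : \sum_(j | j != i) f j = \sum_j f j - f i.
Proof. by rewrite [in RHS](bigD1 i) //= addrAC subrr add0r. Qed.

(* The weight of the edge [e] in the statistic [sum_i (x i - mean) deg i]. *)
Let c (e : 'I_n * 'I_n) : R := a e.1 * a e.2 * (y e.1 + y e.2).

Let sum_c : \sum_(e : 'I_n * 'I_n | (e.1 < e.2)%N) c e = 0.
Proof.
rewrite (_ : \sum_(_ | _) _ = \sum_i \sum_(j | j != i) a i * a j * y i).
  under eq_bigr => i _.
    under eq_bigr => j _ do rewrite mulrAC mulrC.
    rewrite -mulr_suml sumD1 sum_a (_ : _ * _ = a i * y i * (k - 1)); last first.
      by rewrite mulrBl (mulrA (a i)) aa; ring.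
    over.
  by rewrite -mulr_suml sum_ay mul0r.
by rewrite sum_offdiag; apply: eq_bigr => e _; rewrite /c; ring.
Qed.

(** The squares contribute (k-1) times the spread; the cross terms contribute minus the spread, as
    the deviations [y] sum to zero over [U]. *)
Let sum_c2 : \sum_(e : 'I_n * 'I_n | (e.1 < e.2)%N) c e ^+ 2 = (k - 2) * spread.
Proof.
rewrite (_ : \sum_(_ | _) _ =
    \sum_i \sum_(j | j != i) (a j * (a i * y i ^+ 2) + a j * y j * (a i * y i))).
  under eq_bigr => i _.
    rewrite big_split /= -!mulr_suml !sumD1 sum_a sum_ay.
    rewrite (_ : _ + _ = (k - 2) * (a i * y i ^+ 2)); last first.
      rewrite [LHS](_ : _ = k * (a i * y i ^+ 2) - 2 * (a i * a i * y i ^+ 2)).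
        by rewrite aa; ring.
      by ring.
    over.
  by rewrite -mulr_sumr /spread sum_inE.
rewrite sum_offdiag; apply: eq_bigr => e _; rewrite /c exprMn expr2 (mulrACA (a e.1)).
by rewrite !aa; ring.
Qed.

(** The edge probability is (1/4 + mean/2) + (y_i + y_j)/4: its constant part is killed by [sum_c],
    and the rest gives a quarter of [sum_c2]. *)
Let sum_pc : \sum_(e : 'I_n * 'I_n | (e.1 < e.2)%N) edge_prob e * c e = (k - 2) * spread / 4.
Proof.
transitivity (\sum_(e : 'I_n * 'I_n | (e.1 < e.2)%N)
    (c e ^+ 2 / 4 + (1 / 4 + mean / 2) * c e)); last first.
  by rewrite big_split /= -mulr_suml -mulr_sumr sum_c sum_c2 mulr0 addr0.
apply: eq_bigr => e _ /=.
have -> : c e ^+ 2 = c e * (y e.1 + y e.2).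
  by rewrite /c exprMn expr2 (mulrACA (a e.1)) !aa; ring.
by rewrite /edge_prob /y; field.
Qed.

Let sum_c_edge (w : {ffun 'I_n * 'I_n -> bool}) :
  \sum_(e : 'I_n * 'I_n | (e.1 < e.2)%N) c e * (w e)%:R =
  \sum_(i in U) y i * (deg_in (enum U) w i)%:~R.
Proof.
transitivity (\sum_i \sum_(j | j != i) a i * a j * y i * (edge w i j)%:R).
  rewrite sum_offdiag; apply: eq_bigr => -[i j] /= ij.
  by rewrite /edge (upairC j i) /upair ij /c /=; ring.
rewrite sum_inE; apply: eq_bigr => i _.
rewrite /deg_in rmorph_sum /= big_enum_cond /= big_mkcondl /= !mulr_sumr.
apply: eq_bigr => j _; rewrite {2}/a; case: ifP => _; last by rewrite !(mulr0, mul0r).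
by rewrite rmorph_nat mulr1 mulrA.
Qed.

Lemma expect_regular_spread (d : int) :
  expect edge_prob (fun w => (all (fun i => deg_in (enum U) w i == d) (enum U))%:R)
  <= expR (- ((#|U|%:R - 2) * spread / 96)).
Proof.
pose g (e : 'I_n * 'I_n) b : R :=
  if (e.1 < e.2)%N then expR (- (c e * (b : bool)%:R / 12)) else 1.
(* If all degrees equal [d], the exponent is a multiple of d times the sum of the deviations, hence
   0, so the product is 1 and dominates the indicator. *)
apply: (@le_trans _ _ (expect edge_prob (fun w => \prod_e g e (w e)))).
  apply: expect_le => [e|w]; first by have := edge_prob_mid e; lra.
  case: allP => [reg|_]; last first.
    by apply: prodr_ge0 => e _; rewrite /g; case: ifP; rewrite ?expR_ge0.
  rewrite -big_mkcond /= -expR_sum sumrN -mulr_suml sum_c_edge.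
  rewrite (eq_bigr (fun i => y i * d%:~R)); last first.
    by move=> i iU; rewrite (eqP (reg i _)) // mem_enum.
  by rewrite -mulr_suml sum_inE sum_ay !mul0r oppr0 expR0.
rewrite expect_prod.
(* As p <= 3/4, the quadratic term 2p(c/12)^2 is at most c^2/96. The sums of the two terms are
   -(k-2)V/48 and (k-2)V/96. *)
rewrite [leRHS](_ : _ = \prod_(e : 'I_n * 'I_n | (e.1 < e.2)%N)
   expR (edge_prob e * c e * - 12^-1 + c e ^+ 2 * 96^-1)); last first.
  by rewrite -expR_sum big_split /= -!mulr_suml sum_pc sum_c2; congr expR; rewrite /k; field.
rewrite [leRHS]big_mkcond /=; apply: ler_prod => e _.
have /andP[p1 p2] := edge_prob_mid e; rewrite /g.
case: ifP => _; last by rewrite !mulr1 addrC subrK ler01 lexx.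
rewrite mulr0 mul0r oppr0 expR0 !mulr1.
have c_le : - (c e / 12) <= 1 / 2.
  rewrite /c /a; have := x01 e.1; have := x01 e.2; have := mean01.
  by case: (_ \in U); case: (_ \in U); rewrite ?mul1r ?mul0r /y; lra.
apply/andP; split.
  by apply: addr_ge0; [apply: mulr_ge0 (expR_ge0 _)|]; lra.
apply: le_trans (expR_ge1Dx _).
have := expR_le_quad c_le; move: (expR _) => E; nra.
Qed.

End Deviation.
End Chernoff.

(** * Gaussian sums and weighted counting of large sets *)

Section Counting.
Variable R : realType.

Lemma geometric_dist_sum (q : R) (m n : nat) : 0 <= q <= 1 ->
  (1 - q) * \sum_(i < n) q ^+ ((i - m) + (m - i)) <= 2.
Proof.
move=> /andP[q0 q1].
(* With truncated subtraction, the exponent in the sum is |i - m| and this invariant reads q^(m-n)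
   while n <= m and 2 - q^(n-m) afterwards. *)
apply: (@le_trans _ _ (q ^+ (m - n) + 1 - q ^+ (n - m))); last first.
  by have := exprn_ile1 (m - n) q0 q1; have := exprn_ge0 (n - m) q0; lra.
elim: n => [|n IH].
  by rewrite big_ord0 mulr0 sub0n expr0 addrK exprn_ge0.
rewrite big_ord_recr /= mulrDr; apply: le_trans (lerD IH (lexx _)) _.
have [mn|nm] := leqP m n.
  rewrite (_ : m - n = 0)%N; last by lia.
  rewrite (_ : m - n.+1 = 0)%N; last by lia.
  by rewrite subSn // addn0 exprS; lra.
rewrite (_ : n - m = 0)%N; last by lia.
rewrite (_ : n.+1 - m = 0)%N; last by lia.
rewrite (_ : m - n = (m - n.+1).+1)%N; last by lia.
rewrite add0n exprS; move: (exprn_ge0 (m - n.+1) q0).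
by move=> /mulr_ge0/(_ (sqr_ge0 (1 - q))); lra.
Qed.

(** Since -z^2 <= 1/4 - |z|, the sum is dominated by a two-sided geometric one with ratio exp(-g),
    where 1 - exp(-g) >= g/2. *)
Lemma gaussian_sum_le (g : R) (n : nat) (m : 'I_n) : 0 < g <= 1 ->
  \sum_(i < n) expR (- (g * (i%:R - m%:R)) ^+ 2) <= expR (1 / 4) * (4 / g).
Proof.
move=> /andP[g0 g1].
pose q := expR (- g).
have q01 : 0 <= q <= 1 by rewrite expR_ge0 -[leRHS]expR0 ler_expR; lra.
have qg : g / 2 <= 1 - q.
  rewrite /q expRN; have := expR_ge1Dx g; have := expR_gt0 g.
  move: (expR g) => E E0 E1.
  have EV : E * E^-1 = 1 by rewrite divff ?gt_eqF.
  have : 0 < E^-1 by rewrite invr_gt0.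
  move: EV; move: E^-1 => F; nra.
apply: (@le_trans _ _ (\sum_(i < n) expR (1 / 4) * q ^+ ((i - m) + (m - i)))).
  apply: ler_sum => i _; rewrite -expRM_natl -expRD ler_expR.
  have [mi|im] := leqP m i.
    rewrite (_ : m - i = 0)%N; last by lia.
    rewrite addn0 natrB //; have := sqr_ge0 (g * (i%:R - m%:R) - 1 / 2); nra.
  rewrite (_ : i - m = 0)%N; last by lia.
  rewrite add0n natrB ?(ltnW im) //; have := sqr_ge0 (g * (m%:R - i%:R) - 1 / 2); nra.
rewrite -mulr_sumr ler_wpM2l ?expR_ge0 // ler_pdivlMr //.
have := geometric_dist_sum m n q01.
have : 0 <= \sum_(i < n) q ^+ ((i - m) + (m - i)).
  by apply: sumr_ge0 => i _; rewrite exprn_ge0 //; case/andP: q01.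
move: (\sum_(i < n) _) => S; nra.
Qed.

(** Rankin's trick: insert the factor exp(4(|U| - K)) >= 1, extend the sum to all subsets, and
    factor it as a product of 1 + exp(4) a_i. *)
Lemma sum_large_sets_le (T : finType) (a : T -> R) (K : R) :
  (forall i, 0 <= a i) ->
  \sum_(U : {set T} | K <= #|U|%:R) \prod_(i in U) a i <=
  expR (expR 4 * \sum_i a i - 4 * K).
Proof.
move=> a0; rewrite expRD mulr_sumr expR_sum.
apply: (@le_trans _ _ (\prod_i (expR 4 * a i + 1) * expR (- (4 * K)))); last first.
  rewrite ler_wpM2r ?expR_ge0 //; apply: ler_prod => i _.
  by rewrite addrC expR_ge1Dx andbT addr_ge0 // mulr_ge0 ?expR_ge0.
rewrite bigA_distr mulr_suml [leLHS]big_mkcond /=; apply: ler_sum => U _.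
have P0 : 0 <= \prod_(i in U) a i by exact: prodr_ge0.
rewrite -big_mkcond /= big_split /= prodr_const mulrAC -expRM_natl -expRD.
case: ifP => KU; last by rewrite mulr_ge0 ?expR_ge0.
by rewrite ler_peMl // -[leLHS]expR0 ler_expR; lra.
Qed.

Lemma expR_interpolate (P A B t : R) : 0 <= t <= 1 ->
  P <= expR (- A) -> P <= expR (- B) -> P <= expR (- ((1 - t) * A + t * B)).
Proof.
move=> /andP[t0 t1] PA PB.
have [AB|BA] := leP A B; [apply: le_trans PB _|apply: le_trans PA _];
  by rewrite ler_expR; nra.
Qed.

(** The element of [U] nearest to the mean serves. Replacing the mean by a vertex leaves only n
    possible centres for the union bound. *)
Lemma spread_witness (n : nat) (x : 'I_n -> R) (U : {set 'I_n}) : (0 < #|U|)%N ->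
  exists2 m, m \in U & \sum_(i in U) (x i - x m) ^+ 2 <= 4 * spread x U.
Proof.
move=> /card_gt0P[m0 m0U].
case: (@arg_minP _ _ _ m0 (mem U) (fun m => (x m - mean x U) ^+ 2) m0U) => m mU mmin.
exists m => //; rewrite /spread mulr_sumr; apply: ler_sum => i iU.
have := mmin i iU; have := sqr_ge0 (x i - mean x U + (x m - mean x U)); nra.
Qed.

End Counting.

(** * The random graph and the union bound *)

Section RandomGraph.
Variables (R : realType) (n : nat).
Implicit Types (w : {ffun 'I_n * 'I_n -> bool}) (U : {set 'I_n}).

Definition position (i : 'I_n) : R := i%:R / n%:R.

Lemma position01 i : 0 <= position i <= 1.
Proof.
have n0 : (0 < n)%N by case: (n) i => [[]|].
by rewrite divr_ge0 //= ler_pdivrMr ?ltr0n // mul1r ler_nat ltnW.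
Qed.

Lemma expect_regular_le U (d : int) (K g : R) :
  1 / 2 <= ln (n%:R : R) -> 3 <= K -> K <= #|U|%:R ->
  2304 * n%:R ^+ 2 * ln n%:R * g ^+ 2 = K ->
  expect (edge_prob position)
    (fun w => (all (fun i => deg_in (enum U) w i == d) (enum U))%:R)
  <= \sum_(m < n) \prod_(i in U) expR (2 - ln K / 2 - (g * (i%:R - m%:R)) ^+ 2).
Proof.
set L := ln _ => L2 K3 KU gK.
have U0 : (0 < #|U|)%N by rewrite -(ltr0n R); lra.
have n0 : (0 < n)%N by apply: leq_trans U0 (leq_trans (max_card _) _); rewrite card_ord.
have n0R : 0 < n%:R :> R by rewrite ltr0n.
have Un : #|U|%:R <= n%:R :> R by rewrite ler_nat -[leqRHS]card_ord max_card.
have := expect_degrees_le (edge_prob_mid position01) (fun=> d) (enum_uniq (mem U)).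
rewrite -cardE => /le_trans/(_ (prod_inv_sqrt_le _ _)).
rewrite -opprB -/(enum U) -[#|mem U|]/#|U| => PA.
have PB := expect_regular_spread position01 U0 d.
have t01 : 0 <= (2 * L)^-1 <= 1.
  by rewrite invr_ge0 invf_le1; lra.
have P := expR_interpolate t01 PA PB.
have [m mU mS] := spread_witness position U0.
(* Of the sum over centres only the term at the witness is kept. *)
rewrite (bigD1 m) //=; apply: ler_wpDr.
  by apply: sumr_ge0 => j _; apply: prodr_ge0 => i _; exact: expR_ge0.
apply: le_trans P _; rewrite -expR_sum ler_expR big_split /= sumr_const.
rewrite sumrN -[(2 - _) *+ _]mulr_natl.
have -> : \sum_(i in U) (g * (i%:R - m%:R)) ^+ 2 =
    K / (2304 * L) * \sum_(i in U) (position i - position m) ^+ 2.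
  rewrite mulr_sumr; apply: eq_bigr => i _; rewrite -gK /position; field.
  by rewrite !gt_eqF //; lra.
move: mS; clear PA PB gK; set S := \sum_(i in U) _; set V := spread _ _ => SV.
have S0 : 0 <= S by apply: sumr_ge0 => i _; exact: sqr_ge0.
have lK : ln K <= ln (#|U|%:R : R) by rewrite ler_ln ?posrE; lra.
have lU : ln (#|U|%:R : R) <= L by rewrite ler_ln ?posrE; lra.
move: lK lU KU; move: (ln K) (ln #|U|%:R) => l1 l2; set k : R := #|U|%:R => l12 l2L KU.
set t := (2 * L)^-1.
have tL : t * L = 1 / 2 by rewrite /t; field; rewrite gt_eqF; lra.
have -> : K / (2304 * L) = K * t / 1152 by rewrite /t; field; rewrite gt_eqF; lra.
have t0 : 0 <= t by case/andP: t01.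
(* As ln k <= ln n, moving weight t off the degree bound costs at most k/4 in the exponent, within
   the slack between 3/2 and 2. *)
have h1 : k * t * l2 <= k / 2.
  rewrite (_ : k / 2 = k * t * L); last by rewrite -mulrA tL; lra.
  by rewrite ler_wpM2l ?mulr_ge0 //; lra.
(* From K <= k <= 3(k-2) and S <= 4V; hence 1152 = 12 * 96, and 2304 = 2 * 1152 as t = 1/(2L). *)
have h2 : K * t * S / 1152 <= t * ((k - 2) * V / 96).
  have : K * S <= (3 * (k - 2)) * (4 * V) by apply: ler_pM; lra.
  move=> /(ler_wpM2l t0); lra.
have h3 : 0 <= k * t by apply: mulr_ge0 => //; lra.
have h4 : k * l1 <= k * l2 by apply: ler_wpM2l => //; lra.
lra.
Qed.

Definition random_adj w : rel 'I_n := fun i j => (i != j) && edge w i j.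

Lemma random_adj_sym w : symmetric (random_adj w).
Proof. by move=> i j; rewrite /random_adj /edge eq_sym upairC. Qed.

Lemma random_adj_irrefl w : irreflexive (random_adj w).
Proof. by move=> i; rewrite /random_adj eqxx. Qed.

Definition random_graph w : sgraph := SGraph (@random_adj_sym w) (@random_adj_irrefl w).

Lemma deg_in_induced w U (v : @Defs.induced (random_graph w) U) :
  deg_in (enum U) w (val v) = (Defs.degree v)%:Z.
Proof.
rewrite /degree -(card_imset _ val_inj) -sum1_card -natz natr_sum /deg_in.
rewrite big_enum_cond /= big_mkcond [RHS]big_mkcond /=.
apply: eq_bigr => j _; case: ifP => [/andP[jU jv]|jv].
  case: imsetP => [[y]|ney].
    by rewrite inE /= /induced_adj /= /random_adj => /andP[_ e] ->; rewrite e.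
  case e: (edge w (val v) j) => //; case: ney.
  by exists (exist _ j jU); rewrite // inE /= /induced_adj /= /random_adj eq_sym jv.
case: imsetP => // -[y]; rewrite inE /= /induced_adj /= /random_adj => /andP[vy _] jy.
by rewrite jy (valP y) eq_sym vy in jv.
Qed.

Lemma regular_induced_deg w U : (0 < #|U|)%N ->
  Defs.regular (@Defs.induced (random_graph w) U) ->
  exists d : 'I_n.+1, all (fun i => deg_in (enum U) w i == d%:Z) (enum U).
Proof.
move=> /card_gt0P[i0 i0U] /forallP/(_ (exist _ i0 i0U))/forallP reg.
set v0 : @Defs.induced (random_graph w) U := exist _ i0 i0U.
have dn : (Defs.degree v0 < n.+1)%N.
  rewrite ltnS (leq_trans (max_card _)) // card_sig.
  by rewrite (leq_trans (max_card _)) // card_ord.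
exists (Ordinal dn); apply/allP => i; rewrite mem_enum => iU /=.
have := deg_in_induced (exist _ i iU : @Defs.induced (random_graph w) U).
by rewrite /= => ->; rewrite -(eqP (reg _)).
Qed.

Lemma exists_irregular_graph (K : R) :
  1 / 2 <= ln (n%:R : R) -> 3 <= K -> K <= n%:R -> ln n%:R < K ->
  192 * expR 7 * n%:R * Num.sqrt (ln n%:R) <= K ^+ 2 ->
  exists G : sgraph, #|G| = n /\ (max_regular_induced G)%:R <= K.
Proof.
set L := ln _ => L2 K3 Kn LK K2.
have n0R : 0 < n%:R :> R by lra.
have n0 : (0 < n)%N by rewrite -(ltr0n R).
have K0 : 0 < K by lra.
have sL0 : 0 < Num.sqrt L by rewrite sqrtr_gt0; lra.
have sK0 : 0 < Num.sqrt K by rewrite sqrtr_gt0; lra.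
pose g := Num.sqrt K / (48 * n%:R * Num.sqrt L).
have d48 : 0 < 48 * n%:R * Num.sqrt L by rewrite mulr_gt0 // mulr_gt0.
have g0 : 0 < g by rewrite divr_gt0.
have gK : 2304 * n%:R ^+ 2 * L * g ^+ 2 = K.
  rewrite -[in RHS](sqr_sqrtr (ltW K0)) -[in LHS](@sqr_sqrtr _ L) ?/g; last by lra.
  by field; rewrite !gt_eqF.
have g1 : g <= 1.
  rewrite -(@ler_pXn2r _ 2) ?nnegrE ?(ltW g0) // expr1n.
  have nn0 : 0 < n%:R ^+ 2 :> R by rewrite exprn_gt0.
  have d0 : 0 < 2304 * n%:R ^+ 2 * L by move: (n%:R ^+ 2 : R) nn0 => nn; nra.
  rewrite -(ler_pM2l d0) gK mulr1.
  have n1 : 1 <= n%:R :> R by rewrite ler1n.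
  have : n%:R * 1 <= n%:R ^+ 2 :> R by rewrite expr2 ler_pM2l.
  have := ler_wpM2l (ltW nn0) L2; lra.
pose a m i := expR (2 - ln K / 2 - (g * ((i : 'I_n)%:R - (m : 'I_n)%:R)) ^+ 2).
(* The Gaussian sum is of order 1/g, that is n sqrt(L)/sqrt(K), and exp(-ln K / 2) supplies another
   1/sqrt(K). This bound turns the weighted count into at most exp(-3K) per centre and degree. *)
have suma m : expR 4 * \sum_i a m i <= K.
  have -> : \sum_i a m i = expR 2 / Num.sqrt K * \sum_(i < n) expR (- (g * (i%:R - m%:R)) ^+ 2).
    rewrite mulr_sumr; apply: eq_bigr => i _; rewrite /a !expRD; congr (_ * _ * _).
    rewrite expRN; congr _^-1; rewrite -[in RHS](lnK K0) [in RHS](splitr (ln _)).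
    by rewrite expRD -expr2 sqrtr_sqr ger0_norm ?expR_ge0.
  have g01 : 0 < g <= 1 by rewrite g0 g1.
  have E7 : expR 4 * expR 2 * expR (1 / 4) <= expR 7 :> R by rewrite -!expRD ler_expR; lra.
  apply: (@le_trans _ _ (expR 7 * (192 * n%:R * Num.sqrt L) / K)); last first.
    by rewrite ler_pdivrMr // -expr2; apply: le_trans K2; lra.
  apply: (@le_trans _ _ (expR 4 * (expR 2 / Num.sqrt K * (expR (1 / 4) * (4 / g))))).
    rewrite !ler_wpM2l ?divr_ge0 ?expR_ge0 ?(ltW sK0) //.
    exact: gaussian_sum_le.
  rewrite [leLHS](_ : _ = expR 4 * expR 2 * expR (1 / 4) * (192 * n%:R * Num.sqrt L / K)).
    have : 0 <= 192 * n%:R * Num.sqrt L / K.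
      by apply: divr_ge0 (ltW K0); apply: mulr_ge0 (ltW sL0); apply: mulr_ge0.
    by move=> X0; rewrite -[leRHS]mulrA ler_wpM2r.
  rewrite -[in RHS](sqr_sqrtr (ltW K0)) /g; field.
  by rewrite !gt_eqF.
have total : expect (edge_prob position) (fun w =>
    \sum_(U : {set 'I_n} | K <= #|U|%:R) \sum_(d < n.+1)
     (all (fun i => deg_in (enum U) w i == d%:Z) (enum U))%:R) < 1.
  rewrite expect_sum; under eq_bigr => U _ do rewrite expect_sum.
  apply: (@le_lt_trans _ _ (\sum_(U : {set 'I_n} | K <= #|U|%:R)
      \sum_(d < n.+1) \sum_(m < n) \prod_(i in U) a m i)).
    by apply: ler_sum => U KU; apply: ler_sum => d _; exact: expect_regular_le.
  rewrite exchange_big /= sumr_const card_ord exchange_big /=.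
  apply: (@le_lt_trans _ _ ((\sum_(m < n) expR (- (3 * K))) *+ n.+1)).
    rewrite lerMn2r /=; apply: ler_sum => m _.
    apply: le_trans (sum_large_sets_le _ (fun=> expR_ge0 _)) _.
    by rewrite ler_expR; have := suma m; lra.
  rewrite sumr_const card_ord -mulrnA -[_ *+ (_ * _)]mulr_natr expRN ltr_pdivrMl ?expR_gt0 // mulr1.
  (* There are n centres and n+1 degrees, and n(n+1) <= n^3 = exp(3L) < exp(3K). *)
  apply: (@le_lt_trans _ _ (n%:R ^+ 3)).
    rewrite -natrX ler_nat !expnS expn0 muln1 leq_mul2l; apply/orP; right.
    by rewrite -(ler_nat R) natrM -natr1; nra.
  by rewrite -(lnK n0R) -expRM_natl ltr_expR -/L; lra.
(* Otherwise every outcome has a regular set of size at least K, so the counted sum is always at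
   least 1, and so is its expectation. *)
apply: contrapT => noG.
move: total; apply/negP; rewrite -leNgt -[leLHS](expect_cst (edge_prob position) 1).
apply: expect_le => [e|w]; first by have := edge_prob_mid position01 e; lra.
have [U [KU [d dU]]] : exists U, K <= #|U|%:R /\
    exists d : 'I_n.+1, all (fun i => deg_in (enum U) w i == d%:Z) (enum U).
  apply: contrapT => noU; apply: noG; exists (random_graph w).
  split; first by rewrite card_ord.
  have [U regU ->] : exists2 U : {set random_graph w},
      Defs.regular (Defs.induced U) & max_regular_induced (random_graph w) = #|U|.
    have [|U regU maxU] := @eq_bigmax_cond _
        [pred U : {set random_graph w} | Defs.regular (Defs.induced U)] (fun U => #|U|).
      apply/card_gt0P; exists finset.set0; apply/forallP => -[x x0].
      by have := x0; rewrite finset.inE.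
    by exists U => //; rewrite -maxU; apply: eq_bigl.
  have [//|/ltW KU] := leP (#|U|%:R : R) K.
  case: noU; exists U; split => //; apply: regular_induced_deg => //.
  by rewrite -(ltr0n R); lra.
rewrite (bigD1 U) //= (bigD1 d) //= dU -addrA lerDl.
by rewrite addr_ge0 ?sumr_ge0 // => *; rewrite ?sumr_ge0.
Qed.

End RandomGraph.

(** * Choice of the threshold and the final bound *)

Lemma max_regular_induced_le (G : sgraph) : (max_regular_induced G <= #|G|)%N.
Proof. by apply/bigmax_leqP => U _; exact: max_card. Qed.

Lemma min_max_regular_induced_le (G : sgraph) :
  (min_max_regular_induced #|G| <= max_regular_induced G)%N.
Proof.
rewrite /min_max_regular_induced; case: ex_minnP => k _; apply.
by apply/asboolP; exists G.
Qed.

Theorem theorem1p4 (R : realType) :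
  exists C : R, 0 < C /\
    forall n : nat, (2 <= n)%N ->
      (min_max_regular_induced n)%:R <=
        C * n%:R `^ (1 / 2) * (ln n%:R) `^ (3 / 4).
Proof.
exists (20 * expR 4); split; first by rewrite mulr_gt0 ?expR_gt0.
move=> n n2; set C := 20 * expR 4.
have n2R : 2 <= n%:R :> R by rewrite ler_nat.
have L2 : 1 / 2 <= ln (n%:R : R).
  rewrite -ler_expR lnK ?posrE; last by lra.
  have := @expR_le_quad R (1 / 2) (lexx _); lra.
have Ln : ln (n%:R : R) <= n%:R.
  have H : -1 < n%:R - 1 :> R by lra.
  by have := le_ln1Dx H; rewrite addrC subrK; lra.
set L := ln _ in L2 Ln *; set K := _ * _ * _.
(* In terms of h and s the threshold is C s h^3, so all remaining conditions are polynomial. *)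
pose h := L `^ (1 / 4); pose s := Num.sqrt (n%:R : R).
have h4 : h ^+ 4 = L.
  by rewrite -powR_mulrn ?powR_ge0 // -powRrM mul1r mulVf // powRr1 //; lra.
have h34 : L `^ (3 / 4) = h ^+ 3.
  by rewrite -powR_mulrn ?powR_ge0 // -powRrM mul1r mulrC.
have s2 : s ^+ 2 = n%:R by rewrite sqr_sqrtr.
have KE : K = C * s * h ^+ 3 by rewrite /K h34 mul1r powR12_sqrt.
have h0 : 0 <= h by exact: powR_ge0.
have s0 : 0 <= s by exact: sqrtr_ge0.
have sqrtL : Num.sqrt L = h ^+ 2 by rewrite -h4 (exprM h 2 2) sqrtr_sqr ger0_norm ?sqr_ge0.
have h12 : 1 / 2 <= h.
  rewrite leNgt; apply/negP => /ltW hh.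
  have : h ^+ 4 <= (1 / 2) ^+ 4 by rewrite lerXn2r ?nnegrE.
  by rewrite h4; lra.
have C100 : 100 <= C by have := @expR_ge1Dx R 4; rewrite /C; lra.
have s1 : 1 <= s by rewrite leNgt; apply/negP => ?; nra.
have sh : h ^+ 2 <= s.
  rewrite -(@ler_pXn2r _ 2) ?nnegrE ?exprn_ge0 // -exprM s2; lra.
have h3 : 1 / 8 <= h ^+ 3.
  have : (1 / 2) ^+ 3 <= h ^+ 3 by rewrite lerXn2r ?nnegrE //; lra.
  lra.
(* When K exceeds n, the trivial bound by n suffices. *)
have [Kn|/ltW nK] := leP K n%:R; last first.
  apply: le_trans nK; rewrite ler_nat.
  have := leq_trans (min_max_regular_induced_le (edgeless n)) (max_regular_induced_le _).
  by rewrite [#|edgeless n|]card_ord.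
have Cs : 100 * s <= C * s by rewrite ler_wpM2r.
have h2s : h <= 2 * s by nra.
have [|||G [<- GK]] := @exists_irregular_graph R n K L2 _ Kn.
- by rewrite KE; nra.
- rewrite KE -/L -h4.
  have : h ^+ 3 * h < h ^+ 3 * (C * s) by rewrite ltr_pM2l; lra.
  rewrite -exprSr; lra.
- rewrite KE -/L sqrtL.
  (* The choice C = 20 exp(4) gives C^2 L = 400 exp(8) L >= 200 exp(8). *)
  have CC : 192 * expR 7 <= C ^+ 2 * h ^+ 4.
    have e78 : expR 7 <= expR 4 ^+ 2 :> R by rewrite -expRM_natl ler_expR; lra.
    rewrite h4 (_ : C ^+ 2 = 400 * expR 4 ^+ 2); last by rewrite /C; ring.
    have := expR_gt0 (7 : R); nra.
  rewrite (_ : (_ * _) ^+ 2 = C ^+ 2 * h ^+ 4 * (s ^+ 2 * h ^+ 2)); last by ring.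
  by rewrite s2 -(mulrA _ n%:R) ler_wpM2r // mulr_ge0 ?exprn_ge0.
by apply: le_trans GK; rewrite ler_nat min_max_regular_induced_le.
Qed.
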